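(* For every object $X$ of a biclosed $\mathcal V$-action $\mathcal C$ (with $\mathcal V$ a monoidal category), the clone monad and the double-dualization monad on $\mathcal C$ coincide: $\mathbb C_X=\mathbb K_X$, i.e. they have the same underlying endofunctor, the same unit and the same multiplication.
   Context: An object written in place of a morphism denotes its identity. **Actions.** Let $\mathcal V=(\mathcal V,I,\cdot,\alpha,\lambda,\rho)$ be a monoidal category. A $\mathcal V$-action is a category $\mathcal C$ with a functor $*:\mathcal V\times\mathcal C\to\mathcal C$ and natural isomorphisms $\underline\lambda_C:I*C\to C$, $\underline\alpha_{U,V,C}:(U\cdot V)*C\to U*(V*C)$ with $\underline\lambda_{V*C}\circ\underline\alpha_{I,V,C}=\lambda_V*C$, $(V*\underline\lambda_C)\circ\underline\alpha_{V,I,C}=\rho_V*C$ and $(U*\underline\alpha_{V,W,C})\circ\underline\alpha_{U,V\cdot W,C}\circ(\alpha_{U,V,W}*C)=\underline\alpha_{U,V,W*C}\circ\underline\alpha_{U\cdot V,W,C}$. It is biclosed if every functor $(-)*C:\mathcal V\to\mathcal C$ has a right adjoint $\underline{\mathcal C}(C,-)$, with counit $\underline\varepsilon^C_D:\underline{\mathcal C}(C,D)*C\to D$, and every functor $V*(-):\mathcal C\to\mathcal C$ has a right adjoint $[V,-]$, with counit $\varepsilon^V_D:V*[V,D]\to D$. ''Transpose'' refers to these adjunctions; $\underline{\mathcal C}(-,=)$ and $[-,=]$ are bifunctors, contravariant in the first argument. **Strong functors.** A strong endofunctor $(F,\varphi)$ on $\mathcal C$ is an endofunctor $F$ with a natural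 transformation $\varphi_{V,C}:V*FC\to F(V*C)$ such that $F(\underline\lambda_C)\circ\varphi_{I,C}=\underline\lambda_{FC}$ and $\varphi_{U,V*C}\circ(U*\varphi_{V,C})\circ\underline\alpha_{U,V,FC}=F(\underline\alpha_{U,V,C})\circ\varphi_{U\cdot V,C}$. A morphism $\tau:(F,\varphi)\to(F',\varphi')$ is a natural transformation with $\varphi'_{V,C}\circ(V*\tau_C)=\tau_{V*C}\circ\varphi_{V,C}$. Composites carry the strength $G(\varphi)\circ\psi F$ on $GF$, for $(F,\varphi)$ and $(G,\psi)$. **Clone monad $\mathbb C_X$.** Its underlying endofunctor is $\mathrm C_X=[\underline{\mathcal C}(-,X),X]$, with strength $\kappa^X_{V,A}:V*\mathrm C_XA\to\mathrm C_X(V*A)$ the transpose of $\varepsilon^{\underline{\mathcal C}(A,X)}_X\circ(\epsilon_{V,A}*\mathrm C_XA)\circ\underline\alpha^{-1}:\underline{\mathcal C}(V*A,X)*(V*\mathrm C_XA)\to X$, where $\epsilon_{V,A}:\underline{\mathcal C}(V*A,X)\cdot V\to\underline{\mathcal C}(A,X)$ is the transpose of $\underline\varepsilon^{V*A}_X\circ\underline\alpha:(\underline{\mathcal C}(V*A,X)\cdot V)*A\to X$. For a strong endofunctor $(F,\varphi)$, morphisms $f:FX\to X$ of $\mathcal C$ correspond bijectively to strong functor morphisms $\sigma(f):(F,\varphi)\to(\mathrm C_X,\kappa^X)$, where $\sigma(f)_A:FA\to[\underline{\mathcal C}(A,X),X]$ is the transpose of $f\circ F(\underline\varepsilon^A_X)\circ\varphi_{\underline{\mathcal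 C}(A,X),A}:\underline{\mathcal C}(A,X)*FA\to X$; call $\sigma(f)$ the transpose of $f$. Let $\nu:\mathrm C_XX\to X$ be the composite of $[\imath_X,X]:[\underline{\mathcal C}(X,X),X]\to[I,X]$, $\underline\lambda^{-1}:[I,X]\to I*[I,X]$ and $\varepsilon^I_X:I*[I,X]\to X$, with $\imath_X:I\to\underline{\mathcal C}(X,X)$ the transpose of $\underline\lambda_X$. The unit $\mathrm{Id}\to\mathrm C_X$ of $\mathbb C_X$ is the transpose $\sigma(\mathrm{id}_X)$ of $\mathrm{id}_X:\mathrm{Id}(X)\to X$, and its multiplication $\mathrm C_X\mathrm C_X\to\mathrm C_X$ is the transpose $\sigma(\nu\circ\mathrm C_X\nu)$ of $\nu\circ\mathrm C_X\nu:\mathrm C_X\mathrm C_XX\to X$. **Double-dualization monad $\mathbb K_X$.** It is the monad on $\mathcal C$ induced by the adjunction $\underline{\mathcal C}(-,X)\dashv[-,X]:\mathcal V^{\mathrm{op}}\to\mathcal C$. Explicitly: the endofunctor is $\mathrm K_X(A)=[\underline{\mathcal C}(A,X),X]$; the unit has components $A\to\mathrm K_X(A)$ the transposes of $\underline\varepsilon^A_X$; the multiplication has components $[\delta_{\underline{\mathcal C}(A,X)},X]:\mathrm K_X(\mathrm K_XA)\to\mathrm K_X(A)$, where $\delta_V:V\to\underline{\mathcal C}([V,X],X)$ is the transpose of $\varepsilon^V_X:V*[V,X]\to X$. *)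

(* Defs.v *)
From Corelib Require Import ssreflect.
From Stdlib Require Import Program.Tactics.

Set Implicit Arguments.
Unset Strict Implicit.
Unset Printing Implicit Defensive.

Declare Scope cat_scope.
Delimit Scope cat_scope with cat.
Local Open Scope cat_scope.
Local Obligation Tactic := idtac.

Record Category : Type := MkCategory {
  Ob :> Type;
  Hom : Ob -> Ob -> Type;
  idm : forall A, Hom A A;
  comp : forall A B C, Hom B C -> Hom A B -> Hom A C;
  comp_idl : forall A B (f : Hom A B), comp (idm B) f = f;
  comp_idr : forall A B (f : Hom A B), comp f (idm A) = f;
  compA : forall A B C D (h : Hom C D) (g : Hom B C) (f : Hom A B),
    comp h (comp g f) = comp (comp h g) f
}.
Arguments idm {c} A.
Arguments comp {c A B C} g f : rename.

Notation "A ~> B" := (Hom A B) (at level 70, no associativity) : cat_scope.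
Notation "g ∘ f" := (comp g f) (at level 40, left associativity) : cat_scope.

Record Iso (C : Category) (A B : C) : Type := MkIso {
  iso_hom :> A ~> B;
  iso_inv : B ~> A;
  iso_invK : iso_inv ∘ iso_hom = idm A;
  iso_homK : iso_hom ∘ iso_inv = idm B
}.
Notation "i ^-1" := (iso_inv i) (at level 3, left associativity,
  format "i ^-1") : cat_scope.

Definition op (C : Category) : Category :=
  @MkCategory C (fun A B => B ~> A) (@idm C) (fun _ _ _ g f => f ∘ g)
    (fun _ _ f => comp_idr f) (fun _ _ f => comp_idl f)
    (fun _ _ _ _ h g f => eq_sym (compA f g h)).

Program Definition prod_cat (C D : Category) : Category :=
  @MkCategory (C * D)%type
    (fun P Q => ((fst P ~> fst Q) * (snd P ~> snd Q))%type)
    (fun P => (idm (fst P), idm (snd P)))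
    (fun _ _ _ g f => (fst g ∘ fst f, snd g ∘ snd f)) _ _ _.
Next Obligation. by move=> C D [A A'] [B B'] [f f'] /=; rewrite !comp_idl. Qed.
Next Obligation. by move=> C D [A A'] [B B'] [f f'] /=; rewrite !comp_idr. Qed.
Next Obligation. by move=> *; rewrite /= !compA. Qed.

Record Functor (C D : Category) : Type := MkFunctor {
  fobj :> C -> D;
  fmap : forall A B, A ~> B -> fobj A ~> fobj B;
  fmap_id : forall A, fmap (idm A) = idm (fobj A);
  fmap_comp : forall A B E (g : B ~> E) (f : A ~> B),
    fmap (g ∘ f) = fmap g ∘ fmap f
}.
Arguments fmap {C D} F {A B} f : rename.

Definition Id (C : Category) : Functor C C :=
  @MkFunctor C C (fun A => A) (fun _ _ f => f)
    (fun _ => eq_refl) (fun _ _ _ _ _ => eq_refl).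

Program Definition fcomp (C D E : Category) (G : Functor D E) (F : Functor C D)
    : Functor C E :=
  @MkFunctor C E (fun A => G (F A)) (fun _ _ f => fmap G (fmap F f)) _ _.
Next Obligation. by move=> *; rewrite /= !fmap_id. Qed.
Next Obligation. by move=> *; rewrite /= !fmap_comp. Qed.

Definition bimap (A B C : Category) (F : Functor (prod_cat A B) C)
    (a a' : A) (b b' : B) (f : a ~> a') (g : b ~> b') : F (a, b) ~> F (a', b') :=
  @fmap _ _ F (a, b) (a', b') (f, g).
Arguments bimap {A B C} F {a a' b b'} f g.

Record NatTrans (C D : Category) (F G : Functor C D) : Type := MkNatTrans {
  ntc :> forall A, F A ~> G A;
  naturality : forall A B (f : A ~> B), fmap G f ∘ ntc A = ntc B ∘ fmap F f
}.

Record RightAdjoint (A B : Category) (L : Functor A B) : Type := MkRightAdjoint {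
  radj :> Functor B A;
  counit : NatTrans (fcomp L radj) (Id B);
  transpose : forall a b, L a ~> b -> a ~> radj b;
  counit_transpose : forall a b (f : L a ~> b),
    counit b ∘ fmap L (transpose f) = f;
  transpose_unique : forall a b (f : L a ~> b) (g : a ~> radj b),
    counit b ∘ fmap L g = f -> g = transpose f
}.
Arguments counit {A B L} r : rename.
Arguments transpose {A B L} r {a b} f : rename.

Record Monad (C : Category) : Type := MkMonad {
  mfun :> Functor C C;
  munit : NatTrans (Id C) mfun;
  mmult : NatTrans (fcomp mfun mfun) mfun;
  mmult_unitl : forall A, mmult A ∘ munit (mfun A) = idm (mfun A);
  mmult_unitr : forall A, mmult A ∘ fmap mfun (munit A) = idm (mfun A);
  mmultA : forall A, mmult A ∘ mmult (mfun A) = mmult A ∘ fmap mfun (mmult A)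
}.

Section AdjunctionMonad.
Context (A B : Category) (L : Functor A B) (R : RightAdjoint L).

Lemma transpose_inj a b (f g : a ~> R b) :
  counit R b ∘ fmap L f = counit R b ∘ fmap L g -> f = g.
Proof.
by move=> E; rewrite (transpose_unique E); symmetry; apply: transpose_unique.
Qed.

Lemma transpose_comp a a' b (f : L a ~> b) (g : a' ~> a) :
  transpose R f ∘ g = transpose R (f ∘ fmap L g).
Proof. by apply: transpose_unique; rewrite fmap_comp compA counit_transpose. Qed.

Lemma fmap_transpose a b b' (f : L a ~> b) (g : b ~> b') :
  fmap R g ∘ transpose R f = transpose R (g ∘ f).
Proof.
apply: transpose_unique; rewrite fmap_comp compA.
by rewrite -(naturality (counit R) g) -compA counit_transpose.
Qed.

Program Definition adj_unit : NatTrans (Id A) (fcomp R L) :=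
  @MkNatTrans _ _ (Id A) (fcomp R L) (fun a => transpose R (idm (L a))) _.
Next Obligation.
by move=> a b f; rewrite /= fmap_transpose transpose_comp comp_idl comp_idr.
Qed.

Program Definition adj_mult :
    NatTrans (fcomp (fcomp R L) (fcomp R L)) (fcomp R L) :=
  @MkNatTrans _ _ (fcomp (fcomp R L) (fcomp R L)) (fcomp R L)
    (fun a => fmap R (counit R (L a))) _.
Next Obligation.
by move=> a b f; rewrite /= -!fmap_comp -(naturality (counit R) (fmap L f)).
Qed.

Program Definition adj_monad : Monad A := @MkMonad A (fcomp R L) adj_unit adj_mult _ _ _.
Next Obligation.
move=> a; rewrite /= fmap_transpose comp_idr; symmetry; apply: transpose_unique.
by rewrite fmap_id comp_idr.
Qed.
Next Obligation.
by move=> a; rewrite /= -fmap_comp counit_transpose fmap_id.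
Qed.
Next Obligation.
by move=> a; rewrite /= -!fmap_comp -(naturality (counit R) (counit R (L a))).
Qed.

End AdjunctionMonad.

Record MonoidalCategory : Type := MkMonoidalCategory {
  mcat :> Category;
  tensor : Functor (prod_cat mcat mcat) mcat;
  mone : mcat;
  massoc : forall U V W : mcat,
    Iso (tensor (tensor (U, V), W)) (tensor (U, tensor (V, W)));
  mlunit : forall V : mcat, Iso (tensor (mone, V)) V;
  mrunit : forall V : mcat, Iso (tensor (V, mone)) V;
  massoc_natural : forall (U V W U' V' W' : mcat)
      (u : U ~> U') (v : V ~> V') (w : W ~> W'),
    bimap tensor u (bimap tensor v w) ∘ massoc U V W
    = massoc U' V' W' ∘ bimap tensor (bimap tensor u v) w;
  mlunit_natural : forall (V V' : mcat) (v : V ~> V'),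
    v ∘ mlunit V = mlunit V' ∘ bimap tensor (idm mone) v;
  mrunit_natural : forall (V V' : mcat) (v : V ~> V'),
    v ∘ mrunit V = mrunit V' ∘ bimap tensor v (idm mone);
  mtriangle : forall U V : mcat,
    bimap tensor (idm U) (mlunit V) ∘ massoc U mone V
    = bimap tensor (mrunit U) (idm V);
  mpentagon : forall U V W Z : mcat,
    bimap tensor (idm U) (massoc V W Z) ∘ massoc U (tensor (V, W)) Z
      ∘ bimap tensor (massoc U V W) (idm Z)
    = massoc U V (tensor (W, Z)) ∘ massoc (tensor (U, V)) W Z
}.
Arguments mone {m}.
Arguments massoc {m} U V W.
Arguments mlunit {m} V.
Arguments mrunit {m} V.

Notation "U ⊗ V" := (fobj (tensor _) (U, V))
  (at level 35, right associativity) : cat_scope.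
Notation "u ⊗₁ v" := (bimap (tensor _) u v)
  (at level 35, right associativity) : cat_scope.

Record Action (V : MonoidalCategory) (C : Category) : Type := MkAction {
  act : Functor (prod_cat V C) C;
  aunit : forall A : C, Iso (act (mone, A)) A;
  aassoc : forall (S T : V) (A : C), Iso (act (S ⊗ T, A)) (act (S, act (T, A)));
  aunit_natural : forall (A B : C) (f : A ~> B),
    f ∘ aunit A = aunit B ∘ bimap act (idm mone) f;
  aassoc_natural : forall (S T S' T' : V) (A B : C)
      (s : S ~> S') (t : T ~> T') (f : A ~> B),
    bimap act s (bimap act t f) ∘ aassoc S T A
    = aassoc S' T' B ∘ bimap act (s ⊗₁ t) f;
  act_lunit : forall (T : V) (A : C),
    aunit (act (T, A)) ∘ aassoc mone T A = bimap act (mlunit T) (idm A);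
  act_runit : forall (T : V) (A : C),
    bimap act (idm T) (aunit A) ∘ aassoc T mone A = bimap act (mrunit T) (idm A);
  act_pentagon : forall (S T W : V) (A : C),
    bimap act (idm S) (aassoc T W A) ∘ aassoc S (T ⊗ W) A
      ∘ bimap act (massoc S T W) (idm A)
    = aassoc S T (act (W, A)) ∘ aassoc (S ⊗ T) W A
}.
Arguments aunit {V C} a A : rename.
Arguments aassoc {V C} a S T A : rename.

Notation "T ⊙ A" := (fobj (act _) (T, A))
  (at level 35, right associativity) : cat_scope.
Notation "t ⊙₁ f" := (bimap (act _) t f)
  (at level 35, right associativity) : cat_scope.

Section ActionFunctors.
Context (V : MonoidalCategory) (C : Category) (M : Action V C).

Lemma bimap_id (A B D : Category) (F : Functor (prod_cat A B) D) a b :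
  bimap F (idm a) (idm b) = idm (F (a, b)).
Proof. exact: (fmap_id F (a, b)). Qed.

Lemma bimap_comp (A B D : Category) (F : Functor (prod_cat A B) D)
    (a a' a'' : A) (b b' b'' : B) (f' : a' ~> a'') (f : a ~> a')
    (g' : b' ~> b'') (g : b ~> b') :
  bimap F f' g' ∘ bimap F f g = bimap F (f' ∘ f) (g' ∘ g).
Proof.
symmetry.
exact: (@fmap_comp _ _ F (a, b) (a', b') (a'', b'') (f', g') (f, g)).
Qed.

(* [(-) * A : V -> C], whose right adjoint is [C(A, -)] *)
Program Definition act_on (A : C) : Functor V C :=
  @MkFunctor V C (fun T => act M (T, A)) (fun _ _ t => bimap (act M) t (idm A)) _ _.
Next Obligation. by move=> A T; rewrite /= bimap_id. Qed.
Next Obligation. by move=> A S T W t s; rewrite /= bimap_comp comp_idl. Qed.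

(* [T * (-) : C -> C], whose right adjoint is [[T, -]] *)
Program Definition act_by (T : V) : Functor C C :=
  @MkFunctor C C (fun A => act M (T, A)) (fun _ _ f => bimap (act M) (idm T) f) _ _.
Next Obligation. by move=> T A; rewrite /= bimap_id. Qed.
Next Obligation. by move=> T A B E g f; rewrite /= bimap_comp comp_idl. Qed.

End ActionFunctors.

Record Biclosed (V : MonoidalCategory) (C : Category) (M : Action V C) : Type :=
  MkBiclosed {
    hom_adj : forall A : C, RightAdjoint (act_on M A);
    cot_adj : forall T : V, RightAdjoint (act_by M T)
  }.

Record StrongEndo (V : MonoidalCategory) (C : Category) (M : Action V C) : Type :=
  MkStrongEndo {
    sfun :> Functor C C;
    strength : forall (T : V) (A : C), act M (T, sfun A) ~> sfun (act M (T, A));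
    strength_natural : forall (S T : V) (A B : C) (t : S ~> T) (f : A ~> B),
      fmap sfun (t ⊙₁ f) ∘ strength S A = strength T B ∘ (t ⊙₁ fmap sfun f);
    strength_unit : forall A : C,
      fmap sfun (aunit M A) ∘ strength mone A = aunit M (sfun A);
    strength_assoc : forall (S T : V) (A : C),
      strength S (T ⊙ A) ∘ (idm S ⊙₁ strength T A) ∘ aassoc M S T (sfun A)
      = fmap sfun (aassoc M S T A) ∘ strength (S ⊗ T) A
  }.
Arguments strength {V C M} s T A : rename.

Record StrongMorphism (V : MonoidalCategory) (C : Category) (M : Action V C)
    (F G : StrongEndo M) : Type := MkStrongMorphism {
  snat :> NatTrans F G;
  snat_strong : forall (T : V) (A : C),
    strength G T A ∘ (idm T ⊙₁ snat A) = snat (T ⊙ A) ∘ strength F T A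
}.

Program Definition strong_id (V : MonoidalCategory) (C : Category)
    (M : Action V C) : StrongEndo M :=
  @MkStrongEndo V C M (Id C) (fun T A => idm (act M (T, A))) _ _ _.
Next Obligation. by move=> *; rewrite /= comp_idl comp_idr. Qed.
Next Obligation. by move=> *; rewrite /= comp_idr. Qed.
Next Obligation. by move=> *; rewrite /= bimap_id !comp_idl comp_idr. Qed.

Program Definition strong_comp (V : MonoidalCategory) (C : Category)
    (M : Action V C) (G F : StrongEndo M) : StrongEndo M :=
  @MkStrongEndo V C M (fcomp G F)
    (fun T A => fmap G (strength F T A) ∘ strength G T (F A)) _ _ _.
Next Obligation.
move=> V C M G F S T A B t f; rewrite /= compA -fmap_comp strength_natural.
by rewrite fmap_comp -!compA strength_natural.
Qed.
Next Obligation.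
by move=> V C M G F A; rewrite /= compA -fmap_comp strength_unit strength_unit.
Qed.
Next Obligation.
move=> V C M G F S T A /=.
rewrite compA -fmap_comp -strength_assoc !fmap_comp -!compA -strength_assoc.
congr (_ ∘ _); rewrite !compA strength_natural; congr (_ ∘ _).
by rewrite -!compA bimap_comp comp_idl.
Qed.

Section Monads.
Context (V : MonoidalCategory) (C : Category) (M : Action V C) (B : Biclosed M).
Context (X : C).

(* [ihom A D] is [C(A, D)] and [cot T D] is [[T, D]]; [hom_tr] and [cot_tr]
   transpose a map out of [T ⊙ A] into [C(A, D)] and [[T, D]] respectively *)
Local Notation ihom A D := (radj (hom_adj B A) D).
Local Notation cot T D := (radj (cot_adj B T) D).

Definition hom_ev (A D : C) : ihom A D ⊙ A ~> D := counit (hom_adj B A) D.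
Definition cot_ev (T : V) (D : C) : T ⊙ cot T D ~> D := counit (cot_adj B T) D.
Definition hom_tr (T : V) (A D : C) (f : T ⊙ A ~> D) : T ~> ihom A D :=
  transpose (hom_adj B A) f.
Definition cot_tr (T : V) (A D : C) (f : T ⊙ A ~> D) : A ~> cot T D :=
  transpose (cot_adj B T) f.

Lemma hom_trK (T : V) (A D : C) (f : T ⊙ A ~> D) :
  hom_ev A D ∘ (hom_tr f ⊙₁ idm A) = f.
Proof. exact: (counit_transpose (hom_adj B A) f). Qed.

Lemma cot_trK (T : V) (A D : C) (f : T ⊙ A ~> D) :
  cot_ev T D ∘ (idm T ⊙₁ cot_tr f) = f.
Proof. exact: (counit_transpose (cot_adj B T) f). Qed.

Lemma hom_ext (T : V) (A D : C) (f g : T ~> ihom A D) :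
  hom_ev A D ∘ (f ⊙₁ idm A) = hom_ev A D ∘ (g ⊙₁ idm A) -> f = g.
Proof. exact: (@transpose_inj _ _ _ (hom_adj B A)). Qed.

Lemma cot_ext (T : V) (A D : C) (f g : A ~> cot T D) :
  cot_ev T D ∘ (idm T ⊙₁ f) = cot_ev T D ∘ (idm T ⊙₁ g) -> f = g.
Proof. exact: (@transpose_inj _ _ _ (cot_adj B T)). Qed.

(* the actions on morphisms of [C(-, X)] and [[-, X]] *)
Definition hom_pre (A A' : C) (f : A ~> A') : ihom A' X ~> ihom A X :=
  hom_tr (hom_ev A' X ∘ (idm (ihom A' X) ⊙₁ f)).
Definition cot_pre (S T : V) (t : S ~> T) : cot T X ~> cot S X :=
  cot_tr (cot_ev T X ∘ (t ⊙₁ idm (cot T X))).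

Lemma hom_preE (A A' : C) (f : A ~> A') :
  hom_ev A X ∘ (hom_pre f ⊙₁ idm A) = hom_ev A' X ∘ (idm _ ⊙₁ f).
Proof. exact: hom_trK. Qed.

Lemma cot_preE (S T : V) (t : S ~> T) :
  cot_ev S X ∘ (idm S ⊙₁ cot_pre t) = cot_ev T X ∘ (t ⊙₁ idm _).
Proof. exact: cot_trK. Qed.

Lemma act_compl (S T W : V) (A : C) (t : T ~> W) (s : S ~> T) :
  bimap (act M) (t ∘ s) (idm A) = (t ⊙₁ idm A) ∘ (s ⊙₁ idm A).
Proof. by rewrite bimap_comp comp_idl. Qed.

Lemma act_compr (T : V) (A D E : C) (g : D ~> E) (f : A ~> D) :
  bimap (act M) (idm T) (g ∘ f) = (idm T ⊙₁ g) ∘ (idm T ⊙₁ f).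
Proof. by rewrite bimap_comp comp_idl. Qed.

Lemma act_swap (S T : V) (A D : C) (t : S ~> T) (f : A ~> D) :
  (t ⊙₁ idm D) ∘ (idm S ⊙₁ f) = (idm T ⊙₁ f) ∘ bimap (act M) t (idm A).
Proof. by rewrite !bimap_comp !comp_idl !comp_idr. Qed.

Lemma whisk (D : Category) (a b c d : D) (f : b ~> c) (g : a ~> b)
    (h : a ~> c) (k : d ~> a) :
  f ∘ g = h -> f ∘ (g ∘ k) = h ∘ k.
Proof. by rewrite compA => ->. Qed.

(* [C(-, X) : C -> V^op] *)
Program Definition hom_into : Functor C (op V) :=
  @MkFunctor C (op V) (fun A => ihom A X) hom_pre _ _.
Next Obligation.
by move=> A; apply: hom_ext; rewrite hom_preE.
Qed.
Next Obligation.
move=> A D E g f /=; apply: hom_ext.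
rewrite hom_preE act_compl compA hom_preE -compA act_compr compA.
by rewrite -act_swap compA hom_preE.
Qed.

(* [[-, X] : V^op -> C] *)
Program Definition cot_into : Functor (op V) C :=
  @MkFunctor (op V) C (fun T => cot T X) (fun S T t => cot_pre t) _ _.
Next Obligation.
by move=> T; apply: cot_ext; rewrite cot_preE.
Qed.
Next Obligation.
move=> S T W t s /=; apply: cot_ext.
rewrite cot_preE act_compr compA cot_preE -compA act_compl compA.
by rewrite act_swap compA cot_preE.
Qed.

Definition dd_counit (T : V) : T ~> ihom (cot T X) X := hom_tr (cot_ev T X).

Lemma dd_counit_natural (S T : V) (t : S ~> T) :
  dd_counit T ∘ t = hom_pre (cot_pre t) ∘ dd_counit S.
Proof.
apply: hom_ext; rewrite !act_compl compA hom_trK (whisk _ (hom_preE _)).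
by rewrite -compA -act_swap compA hom_trK cot_preE.
Qed.

Definition dd_transpose (A : C) (T : V) (t : T ~> ihom A X) : A ~> cot T X :=
  cot_tr (hom_ev A X ∘ (t ⊙₁ idm A)).

(* the adjunction [C(-, X) -| [-, X] : V^op -> C]; its counit at [T], a morphism
   [C([T, X], X) ~> T] of [V^op], is [dd_counit T] *)
Program Definition dd_adj : RightAdjoint hom_into :=
  @MkRightAdjoint C (op V) hom_into cot_into
    (@MkNatTrans (op V) (op V) (fcomp hom_into cot_into) (Id (op V)) dd_counit _)
    dd_transpose _ _.
Next Obligation. by move=> T S t /=; rewrite dd_counit_natural. Qed.
Next Obligation.
move=> A T t /=; apply: hom_ext; rewrite act_compl (whisk _ (hom_preE _)).
by rewrite -compA -act_swap compA hom_trK cot_trK.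
Qed.
Next Obligation.
move=> A T t f /= <-; apply: cot_ext; rewrite cot_trK act_compl.
by rewrite (whisk _ (hom_preE _)) -compA -act_swap compA hom_trK.
Qed.

Definition double_dualization_monad : Monad C := adj_monad dd_adj.

Lemma double_dualization_unitE (A : C) :
  munit double_dualization_monad A = cot_tr (hom_ev A X).
Proof. by rewrite /= /dd_transpose bimap_id comp_idr. Qed.

Lemma double_dualization_multE (A : C) :
  mmult double_dualization_monad A = cot_pre (dd_counit (ihom A X)).
Proof. by []. Qed.

Definition clone_fun : Functor C C := fcomp cot_into hom_into.

Definition hom_shift (T : V) (A : C) : ihom (T ⊙ A) X ⊗ T ~> ihom A X :=
  hom_tr (hom_ev (T ⊙ A) X ∘ aassoc M (ihom (T ⊙ A) X) T A).

Definition clone_strength (T : V) (A : C) : T ⊙ clone_fun A ~> clone_fun (T ⊙ A) :=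
  cot_tr (cot_ev (ihom A X) X ∘ (hom_shift T A ⊙₁ idm (clone_fun A))
          ∘ (aassoc M (ihom (T ⊙ A) X) T (clone_fun A))^-1).

Lemma hom_shiftE (T : V) (A : C) :
  hom_ev A X ∘ (hom_shift T A ⊙₁ idm A) = hom_ev (T ⊙ A) X ∘ aassoc M _ T A.
Proof. exact: hom_trK. Qed.

Lemma clone_funE (A D : C) (f : A ~> D) :
  cot_ev (ihom D X) X ∘ (idm _ ⊙₁ fmap clone_fun f)
  = cot_ev (ihom A X) X ∘ (hom_pre f ⊙₁ idm (clone_fun A)).
Proof. exact: cot_preE. Qed.

Lemma clone_strengthE (T : V) (A : C) :
  cot_ev (ihom (T ⊙ A) X) X ∘ (idm _ ⊙₁ clone_strength T A)
    ∘ aassoc M (ihom (T ⊙ A) X) T (clone_fun A)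
  = cot_ev (ihom A X) X ∘ (hom_shift T A ⊙₁ idm (clone_fun A)).
Proof. by rewrite cot_trK -[LHS]compA iso_invK comp_idr. Qed.


Lemma hom_pre_ev (P : V) (A D Z : C) (f : A ~> D) (p : P ~> ihom D X)
    (z : Z ~> A) :
  hom_ev A X ∘ ((hom_pre f ∘ p) ⊙₁ z) = hom_ev D X ∘ (p ⊙₁ (f ∘ z)).
Proof.
rewrite -(comp_idl z) -bimap_comp compA hom_preE -compA bimap_comp.
by rewrite !comp_idl.
Qed.

Lemma hom_shift_ev (P S T : V) (A Z : C) (p : P ~> ihom (T ⊙ A) X) (t : S ~> T)
    (z : Z ~> A) :
  hom_ev A X ∘ bimap (act M) (hom_shift T A ∘ (p ⊗₁ t)) z
  = hom_ev (T ⊙ A) X ∘ (p ⊙₁ (t ⊙₁ z)) ∘ aassoc M P S Z.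
Proof.
rewrite -{1}(comp_idl z) -bimap_comp compA hom_shiftE -!compA.
by rewrite aassoc_natural.
Qed.

Lemma clone_fun_ev (P : V) (A D Z : C) (f : A ~> D) (p : P ~> ihom D X)
    (z : Z ~> clone_fun A) :
  cot_ev (ihom D X) X ∘ (p ⊙₁ (fmap clone_fun f ∘ z))
  = cot_ev (ihom A X) X ∘ ((hom_pre f ∘ p) ⊙₁ z).
Proof.
rewrite -{1}(comp_idl p) -bimap_comp compA clone_funE -compA bimap_comp.
by rewrite comp_idl.
Qed.

Lemma clone_strength_ev (P S T : V) (A Z : C) (p : P ~> ihom (T ⊙ A) X)
    (t : S ~> T) (z : Z ~> clone_fun A) :
  cot_ev (ihom (T ⊙ A) X) X ∘ (p ⊙₁ (clone_strength T A ∘ (t ⊙₁ z)))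
    ∘ aassoc M P S Z
  = cot_ev (ihom A X) X ∘ bimap (act M) (hom_shift T A ∘ (p ⊗₁ t)) z.
Proof.
rewrite -{1}(comp_idl p) -bimap_comp compA -!compA aassoc_natural !compA.
by rewrite clone_strengthE -compA bimap_comp comp_idl.
Qed.

Lemma iso_epi (D : Category) (a b c : D) (i : Iso a b) (f g : b ~> c) :
  f ∘ i = g ∘ i -> f = g.
Proof.
by move=> E; rewrite -(comp_idr f) -(comp_idr g) -(iso_homK i) !compA E.
Qed.

Lemma act_iso_epi (S T : V) (A D : C) (i : Iso S T) (f g : T ⊙ A ~> D) :
  f ∘ bimap (act M) i (idm A) = g ∘ bimap (act M) i (idm A) -> f = g.
Proof.
move=> E; rewrite -(comp_idr f) -(comp_idr g) -bimap_id -(iso_homK i) act_compl.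
by rewrite !compA E.
Qed.

Lemma hom_shift_natural (S T : V) (A D : C) (t : S ~> T) (f : A ~> D) :
  hom_pre f ∘ (hom_shift T D ∘ (idm _ ⊗₁ t))
  = hom_shift S A ∘ (hom_pre (t ⊙₁ f) ⊗₁ idm S).
Proof.
apply: hom_ext; rewrite hom_pre_ev !hom_shift_ev bimap_id hom_preE.
by rewrite comp_idr.
Qed.

Lemma hom_shift_unit (A : C) :
  hom_shift mone A ∘ (hom_pre (aunit M A) ⊗₁ idm mone) = mrunit (ihom A X).
Proof.
apply: hom_ext; rewrite hom_shift_ev bimap_id hom_preE.
by rewrite -compA act_runit.
Qed.

Lemma hom_shift_assoc (S T : V) (A : C) :
  hom_shift T A ∘ (hom_shift S (T ⊙ A) ⊗₁ idm T)
  = hom_shift (S ⊗ T) A ∘ (hom_pre (aassoc M S T A) ⊗₁ idm (S ⊗ T))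
    ∘ massoc (ihom (S ⊙ T ⊙ A) X) S T.
Proof.
apply: hom_ext; rewrite hom_shift_ev bimap_id act_compl compA hom_shift_ev.
rewrite bimap_id hom_preE hom_shiftE -compA -act_pentagon.
by rewrite !compA.
Qed.

Program Definition clone_strong : StrongEndo M :=
  @MkStrongEndo V C M clone_fun clone_strength _ _ _.
Next Obligation.
move=> S T A D t f; apply: cot_ext; apply: (iso_epi (i := aassoc M _ _ _)).
rewrite clone_fun_ev -(comp_idr (clone_strength S A)) -bimap_id.
rewrite comp_idr clone_strength_ev -hom_shift_natural clone_strength_ev.
by rewrite -[fmap clone_fun f]comp_idr clone_fun_ev.
Qed.
Next Obligation.
move=> A; apply: cot_ext; apply: (iso_epi (i := aassoc M _ _ _)).
rewrite clone_fun_ev -(comp_idr (clone_strength mone A)) -bimap_id.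
by rewrite comp_idr clone_strength_ev hom_shift_unit -compA act_runit.
Qed.
Next Obligation.
move=> S T A; apply: cot_ext.
apply: (iso_epi (i := aassoc M _ _ _)).
apply: (act_iso_epi (i := massoc _ _ _)).
rewrite clone_fun_ev -(comp_idr (clone_strength (S ⊗ T) A)) -bimap_id.
rewrite comp_idr clone_strength_ev -[RHS]compA bimap_comp comp_idl.
rewrite -hom_shift_assoc act_compr -!compA.
rewrite [_ ∘ (aassoc M _ _ _ ∘ _)]compA act_pentagon !compA.
rewrite clone_strength_ev bimap_id comp_idr.
by rewrite -(comp_idr (clone_strength T A)) -bimap_id clone_strength_ev.
Qed.

(* [f : F X ~> X] corresponds to the strong morphism [sigma f : F -> C_X]; the
   inverse sends [t] to [nu ∘ t X], see [nu_sigma] and [sigma_nu] *)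
Definition sigma_map (F : StrongEndo M) (f : F X ~> X) (A : C) :
    F A ~> clone_fun A :=
  cot_tr (f ∘ fmap F (hom_ev A X) ∘ strength F (ihom A X) A).

Lemma sigma_ev (F : StrongEndo M) (f : F X ~> X) (P : V) (A Z : C)
    (p : P ~> ihom A X) (z : Z ~> A) :
  cot_ev (ihom A X) X ∘ (p ⊙₁ (sigma_map f A ∘ fmap F z))
  = f ∘ fmap F (hom_ev A X ∘ (p ⊙₁ z)) ∘ strength F P Z.
Proof.
rewrite -{1}(comp_idl p) -bimap_comp compA cot_trK fmap_comp -!compA.
by rewrite strength_natural.
Qed.

Lemma sigma_ev1 (F : StrongEndo M) (f : F X ~> X) (P : V) (A : C)
    (p : P ~> ihom A X) :
  cot_ev (ihom A X) X ∘ (p ⊙₁ sigma_map f A)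
  = f ∘ fmap F (hom_ev A X ∘ (p ⊙₁ idm A)) ∘ strength F P A.
Proof. by rewrite -sigma_ev fmap_id comp_idr. Qed.

Program Definition sigma_nat (F : StrongEndo M) (f : F X ~> X) :
    NatTrans F clone_fun :=
  @MkNatTrans C C F clone_fun (sigma_map f) _.
Next Obligation.
move=> F f A D g; apply: cot_ext.
by rewrite clone_fun_ev sigma_ev comp_idr sigma_ev1 hom_preE.
Qed.

Program Definition sigma (F : StrongEndo M) (f : F X ~> X) :
    StrongMorphism F clone_strong :=
  @MkStrongMorphism V C M F clone_strong (sigma_nat f) _.
Next Obligation.
move=> F f T A; apply: cot_ext; apply: (iso_epi (i := aassoc M _ _ _)).
rewrite /= clone_strength_ev sigma_ev1 hom_shift_ev !bimap_id comp_idr.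
rewrite act_compr compA sigma_ev1 bimap_id comp_idr -!compA.
by rewrite fmap_comp -!compA -strength_assoc !compA.
Qed.

Definition hom_unit : mone ~> ihom X X := hom_tr (aunit M X).

Definition nu : clone_fun X ~> X :=
  cot_ev mone X ∘ (aunit M (cot mone X))^-1 ∘ cot_pre hom_unit.

Lemma nu_ev (Z : C) (z : Z ~> clone_fun X) :
  nu ∘ z ∘ aunit M Z = cot_ev (ihom X X) X ∘ (hom_unit ⊙₁ z).
Proof.
rewrite /nu -!compA [cot_pre _ ∘ _]compA aunit_natural.
rewrite [_^-1 ∘ _]compA iso_invK comp_idl act_compr compA cot_preE.
by rewrite -compA bimap_comp comp_idl comp_idr.
Qed.

Lemma nu_sigma (F : StrongEndo M) (f : F X ~> X) : nu ∘ sigma f X = f.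
Proof.
apply: (iso_epi (i := aunit M _)); rewrite nu_ev /= sigma_ev1 hom_trK.
by rewrite -compA strength_unit.
Qed.

Lemma nu_strength (A : C) :
  nu ∘ (fmap clone_fun (hom_ev A X) ∘ clone_strength (ihom A X) A)
  = cot_ev (ihom A X) X.
Proof.
have E : hom_shift (ihom A X) A
    ∘ ((hom_pre (hom_ev A X) ∘ hom_unit) ⊗₁ idm (ihom A X)) = mlunit (ihom A X).
  apply: hom_ext; rewrite hom_shift_ev bimap_id hom_pre_ev comp_idr.
  rewrite -act_lunit compA aunit_natural.
  rewrite -{1}(comp_idl (hom_ev A X)) -{1}(comp_idr hom_unit) -bimap_comp compA.
  by rewrite hom_trK.
apply: (iso_epi (i := aunit M _)); rewrite nu_ev clone_fun_ev.
apply: (iso_epi (i := aassoc M _ _ _)).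
rewrite -(comp_idr (clone_strength _ A)) -bimap_id clone_strength_ev E.
by rewrite -compA act_lunit.
Qed.

Lemma sigma_nu (F : StrongEndo M) (t : StrongMorphism F clone_strong) (A : C) :
  t A = sigma (F := F) (nu ∘ t X) A.
Proof.
apply: cot_ext; rewrite /= sigma_ev1 bimap_id comp_idr.
rewrite -[nu ∘ t X ∘ _]compA -(naturality t) -[nu ∘ _ ∘ _]compA.
rewrite -[fmap _ _ ∘ _ ∘ _]compA -(snat_strong t) [fmap _ _ ∘ _]compA.
rewrite [nu ∘ _]compA.
by rewrite nu_strength.
Qed.

Lemma strong_ext (F : StrongEndo M) (t t' : StrongMorphism F clone_strong) :
  nu ∘ t X = nu ∘ t' X -> forall A, t A = t' A.
Proof. by move=> E A; rewrite (sigma_nu t) (sigma_nu t') E. Qed.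

Definition clone_unit : StrongMorphism (strong_id M) clone_strong :=
  sigma (F := strong_id M) (idm X).

Definition clone_mult : StrongMorphism (strong_comp clone_strong clone_strong)
    clone_strong :=
  sigma (F := strong_comp clone_strong clone_strong) (nu ∘ fmap clone_fun nu).

Program Definition strong_idm (F : StrongEndo M) : StrongMorphism F F :=
  @MkStrongMorphism V C M F F (@MkNatTrans C C F F (fun A => idm (F A)) _) _.
Next Obligation. by move=> F A D f; rewrite comp_idl comp_idr. Qed.
Next Obligation. by move=> F T A; rewrite /= bimap_id comp_idl comp_idr. Qed.

Program Definition strong_vcomp (F G H : StrongEndo M) (u : StrongMorphism G H)
    (t : StrongMorphism F G) : StrongMorphism F H :=
  @MkStrongMorphism V C M F H (@MkNatTrans C C F H (fun A => u A ∘ t A) _) _.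
Next Obligation.
by move=> F G H u t A D f; rewrite compA (naturality u) -!compA (naturality t).
Qed.
Next Obligation.
move=> F G H u t T A; rewrite /= act_compr compA (snat_strong u) -!compA.
by rewrite (snat_strong t).
Qed.

Program Definition unit_whisker : StrongMorphism clone_strong
    (strong_comp clone_strong clone_strong) :=
  @MkStrongMorphism V C M clone_strong (strong_comp clone_strong clone_strong)
    (@MkNatTrans C C clone_fun (fcomp clone_fun clone_fun)
       (fun A => clone_unit (clone_fun A)) _) _.
Next Obligation.
by move=> A D f; exact: (naturality clone_unit (fmap clone_fun f)).
Qed.
Next Obligation.
move=> T A; rewrite [strength _ _ _]/= -compA.
rewrite [X in _ ∘ X](snat_strong clone_unit T (clone_fun A)) /= comp_idr.
exact: (naturality clone_unit (clone_strength T A)).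
Qed.

Program Definition strong_whisker (G F F' : StrongEndo M)
    (t : StrongMorphism F F') : StrongMorphism (strong_comp G F) (strong_comp G F') :=
  @MkStrongMorphism V C M (strong_comp G F) (strong_comp G F')
    (@MkNatTrans C C (fcomp G F) (fcomp G F') (fun A => fmap G (t A)) _) _.
Next Obligation.
by move=> G F F' t A D f; rewrite /= -!fmap_comp (naturality t).
Qed.
Next Obligation.
move=> G F F' t T A /=; rewrite -compA -strength_natural !compA -!fmap_comp.
by rewrite (snat_strong t).
Qed.

Program Definition unit_whisker' : StrongMorphism clone_strong
    (strong_comp clone_strong clone_strong) :=
  @MkStrongMorphism V C M clone_strong (strong_comp clone_strong clone_strong)
    (@MkNatTrans C C clone_fun (fcomp clone_fun clone_fun)
       (fun A => fmap clone_fun (clone_unit A)) _) _.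
Next Obligation.
exact: (naturality (strong_whisker clone_strong clone_unit)).
Qed.
Next Obligation.
move=> T A; rewrite [LHS](snat_strong (strong_whisker clone_strong clone_unit)).
congr (_ ∘ _); change (fmap clone_fun (idm (T ⊙ A)) ∘ clone_strength T A
  = clone_strength T A).
by rewrite fmap_id comp_idl.
Qed.

Program Definition mult_whisker : StrongMorphism
    (strong_comp clone_strong (strong_comp clone_strong clone_strong))
    (strong_comp clone_strong clone_strong) :=
  @MkStrongMorphism V C M
    (strong_comp clone_strong (strong_comp clone_strong clone_strong))
    (strong_comp clone_strong clone_strong)
    (@MkNatTrans C C (fcomp clone_fun (fcomp clone_fun clone_fun))
       (fcomp clone_fun clone_fun) (fun A => clone_mult (clone_fun A)) _) _.
Next Obligation.
by move=> A D f; exact: (naturality clone_mult (fmap clone_fun f)).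
Qed.
Next Obligation.
move=> T A; rewrite [strength _ _ _]/= -compA.
rewrite [X in _ ∘ X](snat_strong clone_mult T (clone_fun A)).
rewrite compA [X in X ∘ _](naturality clone_mult (clone_strength T A)).
rewrite -[LHS]compA; congr (_ ∘ _).
change (fmap clone_fun (fmap clone_fun (clone_strength T A))
    ∘ (fmap clone_fun (clone_strength T (clone_fun A))
       ∘ clone_strength T (clone_fun (clone_fun A)))
  = fmap clone_fun (fmap clone_fun (clone_strength T A)
                    ∘ clone_strength T (clone_fun A))
    ∘ clone_strength T (clone_fun (clone_fun A))).
by rewrite fmap_comp compA.
Qed.

Lemma nu_unit : nu ∘ clone_unit X = idm X.
Proof. exact: (nu_sigma (F := strong_id M) (idm X)). Qed.

Lemma nu_mult : nu ∘ clone_mult X = nu ∘ fmap clone_fun nu.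
Proof. exact: (nu_sigma (F := strong_comp clone_strong clone_strong)). Qed.

Program Definition clone_monad : Monad C :=
  @MkMonad C clone_fun (snat clone_unit) (snat clone_mult) _ _ _.
Next Obligation.
apply: (strong_ext (t := strong_vcomp clone_mult unit_whisker)
          (t' := strong_idm clone_strong)).
rewrite [snat _ X]/= compA nu_mult -compA.
rewrite [X in _ ∘ X](naturality clone_unit nu) compA.
by rewrite nu_unit /= comp_idl comp_idr.
Qed.
Next Obligation.
apply: (strong_ext (t := strong_vcomp clone_mult unit_whisker')
          (t' := strong_idm clone_strong)).
rewrite [snat _ X]/= compA nu_mult -compA.
by rewrite -fmap_comp nu_unit fmap_id.
Qed.
Next Obligation.
apply: (strong_ext (t := strong_vcomp clone_mult mult_whisker)
          (t' := strong_vcomp clone_mult (strong_whisker clone_strong clone_mult))).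
change (nu ∘ (clone_mult X ∘ clone_mult (clone_fun X))
  = nu ∘ (clone_mult X ∘ fmap clone_fun (clone_mult X))).
rewrite [LHS]compA [RHS]compA nu_mult -[LHS]compA -[RHS]compA.
rewrite [X in _ ∘ X = _](naturality clone_mult nu) [LHS]compA nu_mult.
by rewrite -[in RHS]fmap_comp [in RHS]nu_mult [in RHS]fmap_comp [RHS]compA.
Qed.

End Monads.

(* Main.v *)
(** Since [nu] undoes [sigma], the composite [nu ∘ C_X f ∘ kappa] is, for every
    [f : T * A -> X], the evaluation of the double dual of [A] at the transpose
    [T -> C(A, X)] of [f].  Applying this twice to
    [nu ∘ C_X nu ∘ C_X C_X ev ∘ C_X kappa ∘ kappa], the transpose of the clone
    multiplication, leaves the evaluation at [delta], that is, the transpose of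
    [[delta, X]]. *)
From Corelib Require Import ssreflect.
From Stdlib Require Import FunctionalExtensionality ProofIrrelevance.
Require Import Defs.

Local Open Scope cat_scope.

Lemma nat_trans_ext (C D : Category) (F G : Functor C D) (s t : NatTrans F G) :
  (forall A, s A = t A) -> s = t.
Proof.
case: s t => [s sN] [t tN] /= E.
have Est : s = t by apply: functional_extensionality_dep.
by case: t / Est tN {E} => tN; rewrite (proof_irrelevance _ sN tN).
Qed.

(** One [F] suffices: the two endofunctors agree by computation, so no transport arises. *)
Lemma monad_ext (C : Category) (F : Functor C C) (u u' : NatTrans (Id C) F)
    (m m' : NatTrans (fcomp F F) F) l l' r r' a a' :
  (forall A, u A = u' A) -> (forall A, m A = m' A) ->
  @MkMonad C F u m l r a = @MkMonad C F u' m' l' r' a'.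
Proof.
move=> /nat_trans_ext Eu /nat_trans_ext Em.
case: u' / Eu l' r' a' => l' r' a'; case: m' / Em l' r' a' => l' r' a'.
by rewrite (proof_irrelevance _ l l') (proof_irrelevance _ r r')
  (proof_irrelevance _ a a').
Qed.

(** Factor [f] as evaluation after its transpose, slide the transpose past the strength by
    naturality, and apply [nu_strength]. *)
Lemma nu_strength_transpose (V : MonoidalCategory) (C : Category)
    (M : Action V C) (B : Biclosed M) (X : C) (T : V) (A : C) (f : T ⊙ A ~> X) :
  nu B X ∘ (fmap (clone_fun B X) f ∘ clone_strength B X T A)
  = cot_ev B (radj (hom_adj B A) X) X ∘ (hom_tr B f ⊙₁ idm (clone_fun B X A)).
Proof.
rewrite -{1}(hom_trK B f) fmap_comp -(compA (fmap _ (hom_ev B A X))).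
rewrite (strength_natural (clone_strong B X)) fmap_id.
by rewrite [X in _ ∘ X]compA compA nu_strength.
Qed.

(** The identity functor has identity strength, so [sigma] merely transposes [hom_ev]. *)
Lemma clone_unit_dd (V : MonoidalCategory) (C : Category) (M : Action V C)
    (B : Biclosed M) (X A : C) :
  clone_unit B X A = munit (double_dualization_monad B X) A.
Proof.
by rewrite double_dualization_unitE /= /sigma_map /= comp_idl comp_idr.
Qed.

Lemma clone_mult_dd (V : MonoidalCategory) (C : Category) (M : Action V C)
    (B : Biclosed M) (X A : C) :
  clone_mult B X A = mmult (double_dualization_monad B X) A.
Proof.
rewrite double_dualization_multE; apply: cot_ext.
(* [dd_counit] is the transpose of [cot_ev], and [cot_ev] is in turn expanded by [nu_strength]:
   hence the two nested copies of [nu]. *)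
rewrite cot_preE /dd_counit -nu_strength_transpose -[in RHS](nu_strength B X A).
rewrite [LHS]cot_trK.
rewrite [in RHS](fmap_comp (clone_fun B X) (nu B X)).
rewrite [in RHS](fmap_comp (clone_fun B X) (fmap (clone_fun B X) (hom_ev B A X))).
(* [nu] is itself a composite: generalizing it keeps [compA] from unfolding it *)
by move: (nu B X) => n; rewrite [strength _ _ _]/= !compA.
Qed.

Theorem theorem3p6 (V : MonoidalCategory) (C : Category) (M : Action V C)
    (B : Biclosed M) (X : C) :
  clone_monad B X = double_dualization_monad B X.
Proof.
apply: monad_ext => A; first exact: clone_unit_dd.
exact: clone_mult_dd.
Qed.
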